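(* Consider the deterministic optimization problem SCP-opt described in the context, with running cost $f$, terminal cost $g$ and control policy space $\mathcal{U}$. If $f$ and $g$ are convex and of up to quadratic order (i.e. polynomials of degree at most $2$ in $S$), and the control policy space $\mathcal{U}$ is convex, then SCP-opt is a convex optimization problem.
   Context: Fixed data: constant matrices $A,B,C$; drift $\mu:\mathbb{R}^{N_z}\to\mathbb{R}^{N_z}$; matrix-valued diffusion function $\sigma$ on $\mathbb{R}^{N_z}$; initial values $x_0\in\mathbb{R}^{N_x}$, $z_0\in\mathbb{R}^{N_z}$; horizon $T>0$; real functions $f,g$ of $S\in\mathbb{R}^{N_x+N_u+N_z}$; vectors $\phi_i$ and scalars $\bar\phi_i$ for $i$ in an index set $\Omega^C$; a constant $\kappa_\gamma\ge0$. $\mathcal{U}$ is a set of (differentiable) control policies $u:\mathbb{R}^{N_z}\to\mathbb{R}^{N_u}$; convexity of $\mathcal{U}$ means convexity as a set of functions (individual $u$ need not be convex functions). SCP-opt: the decision variables are $u\in\mathcal{U}$, the trajectories $\widetilde S_t,\widehat S_t$ ($0\le t\le T$), real numbers $\widetilde J_0,\widetilde J_1$, and symmetric $N_z\times N_z$ matrices $l_t$ ($0\le t\le T$). Minimize $J=\widetilde J_0+\widetilde J_1$ subject to: (1) $\dot{\widetilde X}_t=A\widetilde X_t+Bu(\widetilde Z_t)+C\widetilde Z_t$, $\dot{\widetilde Z}_t=\mu(\widetilde Z_t)$, $\widetilde X_0=x_0$, $\widetilde Z_0=z_0$, with $\widetilde S_t=(\widetilde X_t,u(\widetilde Z_t),\widetilde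 Z_t)$ (stacked vector); (2) $\dot{\widehat X}_t=A\widehat X_t+B\frac{\partial u}{\partial z}(\widetilde Z_t)\widehat Z_t+C\widehat Z_t$, $\dot{\widehat Z}_t=\frac{\partial\mu}{\partial z}(\widetilde Z_t)\widehat Z_t$, $\widehat X_0=0_{N_x\times N_z}$, $\widehat Z_0=I_{N_z}$, with $\widehat S_t$ the vertical concatenation of $\widehat X_t$, $\frac{\partial u}{\partial z}(\widetilde Z_t)\widehat Z_t$, $\widehat Z_t$; (3) $\widetilde J_1=\int_0^T\frac12\operatorname{tr}\big(\sigma(\widetilde Z_t)^\top l_t\,\sigma(\widetilde Z_t)\big)dt$; (4) $\widetilde J_0\ge\int_0^Tf(\widetilde S_t)\,dt+g(\widetilde S_T)$; (5) for all $t\in[0,T]$, $l_t\ge\int_0^t\widehat S_s^\top[\nabla^2f]\widehat S_s\,ds+\widehat S_t^\top[\nabla^2g]\widehat S_t$ in the positive semidefinite order (when $f,g$ are of up to quadratic order the Hessians $\nabla^2f,\nabla^2g$ are constant matrices); (6) for all $t\in[0,T]$ and $i\in\Omega^C$, $$\kappa_\gamma\sqrt{\int_0^t\operatorname{tr}\big(\sigma(\widetilde Z_s)^\top\widehat S_s^\top\phi_i\phi_i^\top\widehat S_s\,\sigma(\widetilde Z_s)\big)ds}+\phi_i^\top\widetilde S_t\le\bar\phi_i .$$ ''Convex optimization problem'' means that the objective is a convex function of the decision variables and the set of feasible decision variables is convex.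
   Formalization: The drift is assumed differentiable and locally Lipschitz (without it solutions of the Z-equation need not be unique and the feasible set can fail to be convex), and the diffusion function is assumed Borel measurable so that the integrals make sense. *)

(* Defs.v *)
From HB Require Import structures.
From mathcomp Require Import all_boot all_order all_algebra.
From mathcomp Require Import all_classical all_reals all_analysis.
Set Implicit Arguments.
Unset Strict Implicit.
Unset Printing Implicit Defensive.
Import Order.TTheory GRing.Theory Num.Theory.
Import numFieldNormedType.Exports.
Local Open Scope classical_set_scope.
Local Open Scope ring_scope.

Section calculus.
Context {R : realType}.

(* Column-vector convention: the (i, j) entry is the partial derivative of the
   i-th component in the j-th coordinate.  (The library's [jacobian] acts on
   row vectors and is the transpose of this matrix.) *)
Definition jacobian_cV m n (h : 'cV[R]_n -> 'cV[R]_m) (z : 'cV[R]_n) :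
    'M[R]_(m, n) :=
  \matrix_(i, j) ('D_(delta_mx j 0) h z) i 0.

Definition hessian n (f : 'cV[R]_n -> R) (x : 'cV[R]_n) : 'M[R]_n :=
  \matrix_(i, j) 'D_(delta_mx i 0) (fun y => 'D_(delta_mx j 0) f y) x.

(* [F] has derivative [v] at [t] relative to [D]; at an end point of an interval
   this is the one-sided derivative. *)
Definition deriv_within (D : set R) (V : normedModType R) (F : R -> V) (t : R)
    (v : V) : Prop :=
  (s - t)^-1 *: (F s - F t) @[s --> within D t^'] --> v.

Definition locally_lipschitz (V W : normedModType R) (h : V -> W) : Prop :=
  forall z : V, exists2 N : set V, nbhs z N & [lipschitz h y | y in N].

Definition borel_matrix n p q (h : 'cV[R]_n -> 'M[R]_(p, q)) : Prop :=
  forall i j, measurable_fun setT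
    (fun z : g_sigma_algebraType (@open 'cV[R]_n) => h z i j).

Definition degree_le2 n (f : 'cV[R]_n -> R) : Prop :=
  exists (c : R) (b : 'I_n -> R) (a : 'I_n -> 'I_n -> R), forall x,
    f x = c + \sum_i b i * x i 0 + \sum_i \sum_j a i j * (x i 0 * x j 0).

Definition psd n (M : 'M[R]_n) : Prop :=
  M^T = M /\ forall v : 'cV[R]_n, 0 <= (v^T *m M *m v) 0 0.

Definition loewner_ge n (M N : 'M[R]_n) : Prop := psd (M - N).

Definition integrable_on (D : set R) (h : R -> R) : Prop :=
  (@lebesgue_measure R).-integrable D (EFin \o h).

Definition mx_integral p q (D : set R) (M : R -> 'M[R]_(p, q)) : 'M[R]_(p, q) :=
  \matrix_(i, j) \int[@lebesgue_measure R]_(s in D) M s i j.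

Definition mx_integrable_on p q (D : set R) (M : R -> 'M[R]_(p, q)) : Prop :=
  forall i j, integrable_on D (fun s => M s i j).

End calculus.

Definition convex_problem (R : realType) (V : lmodType R)
    (objective : V -> R) (feasible : set V) : Prop :=
  @convex_function R V setT objective /\ @convex_set R V feasible.

Record scp_data (R : realType) (nx nu nz nw : nat) (I : Type) := SCPData {
  matA : 'M[R]_(nx, nx);
  matB : 'M[R]_(nx, nu);
  matC : 'M[R]_(nx, nz);
  drift : 'cV[R]_nz -> 'cV[R]_nz;
  diffusion : 'cV[R]_nz -> 'M[R]_(nz, nw);
  initx : 'cV[R]_nx;
  initz : 'cV[R]_nz;
  horizon : R;
  run_cost : 'cV[R]_(nx + nu + nz) -> R;
  end_cost : 'cV[R]_(nx + nu + nz) -> R;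
  phi : I -> 'cV[R]_(nx + nu + nz);
  phibar : I -> R;
  kappa : R;
  policies : set ('cV[R]_nz -> 'cV[R]_nu)
}.

Section scp.
Context {R : realType} {nx nu nz nw : nat} {I : Type}.

(* The blocks of the stacked vector (or matrix) (X, U, Z). *)
Definition xpart q (S : 'M[R]_(nx + nu + nz, q)) : 'M[R]_(nx, q) :=
  usubmx (usubmx S).
Definition upart q (S : 'M[R]_(nx + nu + nz, q)) : 'M[R]_(nu, q) :=
  dsubmx (usubmx S).
Definition zpart q (S : 'M[R]_(nx + nu + nz, q)) : 'M[R]_(nz, q) := dsubmx S.

(* The decision variables (u, S~, S^, J~0, J~1, l).  Trajectories are total
   functions of time, constrained on [0, T] only. *)
Definition decision : lmodType R :=
  (('cV[R]_nz -> 'cV[R]_nu) *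
   (R -> 'cV[R]_(nx + nu + nz)) *
   (R -> 'M[R]_(nx + nu + nz, nz)) *
   R^o * R^o *
   (R -> 'M[R]_nz))%type.

Variable P : scp_data R nx nu nz nw I.

Let A := matA P.
Let B := matB P.
Let C := matC P.
Let mu := drift P.
Let sigma := diffusion P.
Let T := horizon P.
Let f := run_cost P.
Let g := end_cost P.

Definition nominal_dynamics (u : 'cV[R]_nz -> 'cV[R]_nu)
    (S : R -> 'cV[R]_(nx + nu + nz)) : Prop :=
  let X t := xpart (S t) in
  let Z t := zpart (S t) in
  [/\ X 0 = initx P, Z 0 = initz P &
    forall t, t \in `[0, T] ->
      [/\ upart (S t) = u (Z t),
          deriv_within `[0, T] X t (A *m X t + B *m u (Z t) + C *m Z t) &
          deriv_within `[0, T] Z t (mu (Z t))]].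

Definition linearized_dynamics (u : 'cV[R]_nz -> 'cV[R]_nu)
    (S : R -> 'cV[R]_(nx + nu + nz))
    (Sh : R -> 'M[R]_(nx + nu + nz, nz)) : Prop :=
  let Z t := zpart (S t) in
  let Xh t := xpart (Sh t) in
  let Zh t := zpart (Sh t) in
  [/\ Xh 0 = 0, Zh 0 = 1%:M &
    forall t, t \in `[0, T] ->
      [/\ upart (Sh t) = jacobian_cV u (Z t) *m Zh t,
          deriv_within `[0, T] Xh t
            (A *m Xh t + B *m (jacobian_cV u (Z t) *m Zh t) + C *m Zh t) &
          deriv_within `[0, T] Zh t (jacobian_cV mu (Z t) *m Zh t)]].

(* In this and the next constraints the integrability clauses say that the
   integrals exist: the library's integral is a total function. *)
Definition second_order_cost (S : R -> 'cV[R]_(nx + nu + nz)) (J1 : R)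
    (l : R -> 'M[R]_nz) : Prop :=
  let c t :=
    2^-1 * \tr ((sigma (zpart (S t)))^T *m l t *m sigma (zpart (S t))) in
  integrable_on `[0, T] c /\
  J1 = \int[@lebesgue_measure R]_(t in `[0, T]) c t.

Definition nominal_cost (S : R -> 'cV[R]_(nx + nu + nz)) (J0 : R) : Prop :=
  integrable_on `[0, T] (f \o S) /\
  J0 >= (\int[@lebesgue_measure R]_(t in `[0, T]) f (S t)) + g (S T).

(* The Hessians are taken along the nominal trajectory; when [f] and [g] have
   degree at most 2 they do not depend on the point. *)
Definition hessian_constraint (S : R -> 'cV[R]_(nx + nu + nz))
    (Sh : R -> 'M[R]_(nx + nu + nz, nz)) (l : R -> 'M[R]_nz) : Prop :=
  let F s := (Sh s)^T *m hessian f (S s) *m Sh s in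
  let G t := (Sh t)^T *m hessian g (S t) *m Sh t in
  mx_integrable_on `[0, T] F /\
  forall t, t \in `[0, T] -> loewner_ge (l t) (mx_integral `[0, t] F + G t).

Definition chance_constraint (S : R -> 'cV[R]_(nx + nu + nz))
    (Sh : R -> 'M[R]_(nx + nu + nz, nz)) : Prop :=
  forall i : I,
  let p := phi P i in
  let v s := \tr ((sigma (zpart (S s)))^T *m (Sh s)^T *m p *m p^T *m
                  Sh s *m sigma (zpart (S s))) in
  integrable_on `[0, T] v /\
  forall t, t \in `[0, T] ->
    kappa P * Num.sqrt (\int[@lebesgue_measure R]_(s in `[0, t]) v s)
      + (p^T *m S t) 0 0 <= phibar P i.

Definition scp_feasible : set decision :=
  [set d | let: (u, tS, hS, J0, J1, l) := d in
    [/\ policies P u,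
        forall t, t \in `[0, T] -> (l t)^T = l t,
        nominal_dynamics u tS /\ linearized_dynamics u tS hS,
        second_order_cost tS J1 l /\ nominal_cost tS J0 &
        hessian_constraint tS hS l /\ chance_constraint tS hS]].

Definition scp_objective (d : decision) : R :=
  let: (_, _, _, J0, J1, _) := d in J0 + J1.

End scp.

(* Main.v *)
Require Import Defs.
From HB Require Import structures.
From mathcomp Require Import all_boot all_order all_algebra.
From mathcomp Require Import all_classical all_reals all_analysis.
Import Order.TTheory GRing.Theory Num.Theory.
Import numFieldNormedType.Exports.
Local Open Scope classical_set_scope.
Local Open Scope ring_scope.
From mathcomp Require Import measurable_realfun ring lra.

(* The equation for Z does not involve the control, so by local Lipschitz
   continuity of the drift all feasible points share the same Z~ on [0, T]; the
   equation for Z^ is then a common linear equation with locally bounded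
   coefficients, so Z^ is shared as well.  Hence every product that could break
   convexity (u with Z~, du/dz with Z^, sigma with l) is affine along a segment
   of feasible points.  What remains is Jensen's inequality for the quadratic f
   and g (whose Hessians are constant and positive semidefinite) and
   Minkowski's inequality for the chance constraint.  The integrals at a
   combination exist because positive semidefinite forms are dominated by the
   same combination of the forms at the end points. *)

Set Implicit Arguments.
Unset Strict Implicit.
Unset Printing Implicit Defensive.

(** * Uniqueness for ordinary differential equations *)

Section ode.
Context {R : realType}.
Implicit Types (D : set R) (t a b : R).

(** The coefficients are arbitrary: [1] and [-1] serve the uniqueness proofs, [a] and [b] the convex
    combinations. *)
Lemma deriv_within_comb D (V : normedModType R) (F G : R -> V) t v w a b :
  deriv_within D F t v -> deriv_within D G t w ->
  deriv_within D (fun s => a *: F s + b *: G s) t (a *: v + b *: w).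
Proof.
move=> dF dG; rewrite /deriv_within.
rewrite (_ : (fun s => _) = (fun s => a *: ((s - t)^-1 *: (F s - F t)) +
    b *: ((s - t)^-1 *: (G s - G t)))); last first.
  apply/funext => s; rewrite opprD addrACA -!scalerBr scalerDr !scalerA.
  by rewrite ![_^-1 * _]mulrC.
by apply: cvgD; apply: cvgZr.
Qed.

#[global] Arguments deriv_within_comb {D V F G t v w} a b _ _.

(** The limit is taken within [D], so agreement on [D] is enough; [D t] is required because the
    value at [t] enters every difference quotient. *)
Lemma deriv_within_eq D (V : normedModType R) (F G : R -> V) t v w :
  D t -> {in D, F =1 G} -> v = w ->
  deriv_within D F t v -> deriv_within D G t w.
Proof.
move=> Dt FG <-; apply: cvg_trans; apply: near_eq_cvg.
near=> s; rewrite (FG t (mem_set Dt)) (FG s)//.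
by apply/mem_set; near: s; exact: withinT.
Unshelve. all: end_near. Qed.

Lemma deriv_within_entry D m n (F : R -> 'M[R]_(m, n)) t v :
  deriv_within D F t v -> forall i j,
  deriv_within D (fun s => F s i j : R^o) t (v i j).
Proof.
move=> dF i j; rewrite /deriv_within.
rewrite (_ : (fun s => _) =
  (fun M : 'M[R]_(m, n) => M i j) \o (fun s => (s - t)^-1 *: (F s - F t))).
  exact: cvg_comp dF (@coord_continuous _ _ _ _ _ _).
by apply/funext => s /=; rewrite !mxE.
Qed.

#[global] Arguments deriv_within_entry {D m n F t v} dF i j.

Lemma deriv_within_cvg D (V : normedModType R) (F : R -> V) t v :
  deriv_within D F t v -> F s @[s --> within D (nbhs t)] --> F t.
Proof.
move=> dF.
have FF : F s @[s --> within D t^'] --> F t.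
  have s0 : (s - t : R^o) @[s --> within D t^'] --> (0 : R^o).
    rewrite -(subrr (t : R^o)); apply: cvgB; last exact: cvg_cst.
    by apply: (cvg_trans (cvg_within _)); exact: cvg_within.
  have := cvgD (cvg_cst (F t)) (cvgZ s0 dF).
  rewrite scale0r addr0 => /(_ _ _ _); apply: cvg_trans; apply: near_eq_cvg.
  near=> s; change (F t + (s - t) *: ((s - t)^-1 *: (F s - F t)) = F s).
  rewrite scalerA mulfV ?scale1r ?subrKC// subr_eq0.
  by near: s; rewrite !near_withinE; apply: filterE => s.
(* The limit so far is over a punctured neighbourhood. At [s = t] the claim is that [P] holds at
   [F t], which [PF] gives. *)
move=> P PF; have := FF _ PF; rewrite /nbhs/= /within/= => h.
have {h} : \forall s \near t, s != t -> D s -> P (F s) by [].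
apply: filterS => s; have [->|st] := eqVneq s t; last exact.
by move=> _ _; exact: nbhs_singleton.
Unshelve. all: end_near. Qed.

(** At an interior point small increments stay inside the interval, so the limit relative to it is
    the ordinary derivative. *)
Lemma deriv_within_is_derive (V : normedModType R) (F : R -> V) t v a b :
  t \in `]a, b[ -> deriv_within `[a, b] F t v -> is_derive t 1 F v.
Proof.
move=> tab dF.
have sh : (h *: 1 + t) @[h --> 0^'] --> within `[a, b] t^'.
  move=> P PP.
  have {PP} : \forall s \near t, s != t -> s \in `[a, b] -> P s.
    by move: PP; rewrite /nbhs/= /within/=.
  move=> /nbhs_ballP[e /= e0 eP].
  have /nbhs_ballP[d /= d0 dP] := near_in_itvoo tab.
  change (\forall h \near 0^', P (h *: 1 + t)); near=> h.
  have h0 : h != 0 by near: h; rewrite near_withinE; apply: filterE => h.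
  have hd : `|h| < Num.min e d.
    near: h; apply: nbhs_dnbhs; apply/nbhs_ballP; exists (Num.min e d) => /=.
      by rewrite lt_min e0.
    by move=> h; rewrite /ball/= sub0r normrN.
  move: hd; rewrite lt_min => /andP[he hd].
  have E : t - (h *: 1 + t) = - h.
    by rewrite [_ *: _]mulr1 opprD addrA addrAC subrr add0r.
  apply: eP.
  - by rewrite /ball/= E normrN.
  - by rewrite -subr_eq0 -oppr_eq0 opprB E oppr_eq0.
  - apply: subset_itv_oo_cc; apply: dP.
    by rewrite /ball/= E normrN.
have : h^-1 *: ((F \o shift t) (h *: 1) - F t) @[h --> 0^'] --> v.
  have := cvg_comp _ _ sh dF; apply: cvg_trans; apply: near_eq_cvg.
  by near=> h; rewrite /= addrK [h *: 1]mulr1.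
move=> dFv; apply: DeriveDef; first by apply/cvg_ex; exists v.
exact: cvg_lim dFv.
Unshelve. all: end_near. Qed.

Lemma cvg_sumr (T : Type) (F : set_system T) {FF : Filter F} (I : Type)
    (r : seq I) (V : normedModType R) (f : I -> T -> V) (l : I -> V) :
  (forall i, f i x @[x --> F] --> l i) ->
  \sum_(i <- r) f i x @[x --> F] --> \sum_(i <- r) l i.
Proof. by move=> fl; apply: cvg_big => //; exact: add_continuous. Qed.

(** Multiplying by the integrating factor [expR (- K * s)] gives a function with nonpositive
    derivative, hence nonincreasing; the factor is positive and does not change signs. *)
Lemma gronwall_le0 (T K : R) (e e' : R -> R^o) :
  {within `[0, T], continuous e} ->
  (forall t, t \in `]0, T[ -> is_derive t 1 e (e' t)) ->
  (forall t, t \in `]0, T[ -> e' t <= K * e t) ->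
  e 0 <= 0 -> forall t, t \in `[0, T] -> e t <= 0.
Proof.
move=> ce de e'K e0 t tT.
pose k (s : R^o) : R^o := expR (- K * s).
have dk (s : R^o) : is_derive s 1 k (- K * k s).
  rewrite mulrC; apply: is_derive1_comp.
  by apply: is_derive_eq; rewrite scaler1.
have dh s : s \in `]0, T[ -> is_derive s 1 (e * k) (k s * (e' s - K * e s)).
  move=> sT; have := de s sT => des; apply: is_derive_eq.
  by rewrite /GRing.scale/=; ring.
have ch : {within `[0, T], continuous (e * k)}.
  apply/subspace_continuousP => s sT; apply: cvgM.
    by move/subspace_continuousP : ce; exact.
  apply: cvg_within_filter.
  have [/derivable1_diffP/differentiable_continuous ck _] := dk s; exact: ck.
have T0 : 0 <= T by move: tT; rewrite in_itv/= => /andP[]; exact: le_trans.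
have : (e * k) t <= (e * k) 0.
  apply: (@ler0_derive1_le_cc _ (e * k) 0 T) => //.
  - by move=> s sT; case: (dh s sT).
  - move=> s sT; rewrite derive1E (@derive_val _ _ _ _ _ _ _ (dh s sT)).
    by rewrite mulr_ge0_le0 ?expR_ge0// subr_le0 e'K.
  - by rewrite bound_itvE.
  - by move: tT; rewrite in_itv/= => /andP[].
have k0 s : 0 < k s by exact: expR_gt0.
move=> h; have : e t * k t <= 0.
  by apply: le_trans h _; rewrite mulr_le0_ge0// ltW.
by rewrite pmulr_lle0.
Qed.

Lemma ler_mx_entry m n (M : 'M[R]_(m, n)) i j : `|M i j| <= `|M|.
Proof.
rewrite [leRHS]/Num.Def.normr/= mx_normrE.
by apply: le_trans (le_bigmax _ _ (i, j)).
Qed.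

Lemma ler_sum2_cst m n (f : 'I_m -> 'I_n -> R) c :
  (forall i j, f i j <= c) -> \sum_i \sum_j f i j <= (m * n)%:R * c.
Proof.
move=> fc; have [cm cn] := (card_ord m, card_ord n).
rewrite natrM -mulrA mulr_natl -[X in _ *+ X]cm -sumr_const.
apply: ler_sum => i _.
by rewrite mulr_natl -[X in _ *+ X]cn -sumr_const; apply: ler_sum => j _.
Qed.

(** The matrix norm is the largest absolute entry, so its square is one of the terms of the sum. *)
Lemma mx_norm_sqr_le m n (M : 'M[R]_(m, n)) :
  `|M| ^+ 2 <= \sum_i \sum_j M i j ^+ 2.
Proof.
have S0 : 0 <= \sum_i \sum_j M i j ^+ 2.
  by do 2 apply: sumr_ge0 => ? _; exact: sqr_ge0.
have [-> |M0] := eqVneq `|M| 0; first by rewrite expr0n.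
have [[i j] /= E] := mx_norm_neq0 M0; rewrite [`|M|]E.
rewrite -normrX ger0_norm ?sqr_ge0// (bigD1 i)//= (bigD1 j)//= -addrA lerDl.
by rewrite addr_ge0// sumr_ge0// => *; rewrite ?sumr_ge0// => *; exact: sqr_ge0.
Qed.

(** Gronwall's lemma applies to the sum [e] of the squared entries, which is differentiable where
    the norm need not be. The rate bound is assumed only locally, the form in which it is available
    along trajectories. *)
Lemma ode_vanish (T : R) m n (F F' : R -> 'M[R]_(m, n)) : F 0 = 0 ->
  (forall t, t \in `[0, T] -> deriv_within `[0, T] F t (F' t)) ->
  (forall t, t \in `[0, T] -> exists L, \forall s \near within `[0, T] (nbhs t),
    `|F' s| <= L * `|F s|) ->
  forall t, t \in `[0, T] -> F t = 0.
Proof.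
move=> F0 dF FL.
(* Compactness of the interval, used with the filter of large constants: a local bound survives
   enlarging [L], so one constant serves all times. *)
have [L LP] : exists L, forall s, s \in `[0, T] -> `|F' s| <= L * `|F s|.
  have := iffLR (compact_near_coveringP _) (@segment_compact R 0 T).
  move=> /(_ R +oo (fun L s => s \in `[0, T] -> `|F' s| <= L * `|F s|)).
  case.
    move=> t /= tT; have [L HL] := FL t tT.
    exists ([set s | s \in `[0, T] -> `|F' s| <= L * `|F s|], [set M | L <= M]).
      split; last by apply: nbhs_pinfty_ge; rewrite num_real.
      by move: HL; rewrite near_withinE.
    move=> [s M] /= [sP LM] /sP /le_trans; apply.
    by rewrite ler_wpM2r.
  move=> M [_ MP]; exists (M + 1) => s sT; apply: (MP (M + 1)) => //.
  by rewrite ltrDl.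
have {L LP} [L L0 LP] :
    exists2 L, 0 <= L & forall s, s \in `[0, T] -> `|F' s| <= L * `|F s|.
  exists `|L| => // s /LP /le_trans; apply.
  by rewrite ler_wpM2r// ler_norm.
pose e (s : R) : R^o := \sum_i \sum_j F s i j ^+ 2.
pose e' (s : R) : R^o := \sum_i \sum_j 2 * (F s i j * F' s i j).
have e_eq0 s : e s <= 0 -> F s = 0.
  move=> es; have := le_trans (mx_norm_sqr_le (F s)) es.
  by rewrite exprn_even_le0//= normr_eq0 => /eqP.
move=> t tT; apply: e_eq0; move: t tT.
apply: (@gronwall_le0 T ((m * n)%:R * (2 * L)) e e').
- apply/subspace_continuousP => s sT.
  apply: cvg_sumr => i; apply: cvg_sumr => j.
  have cF := deriv_within_cvg (deriv_within_entry (dF s sT) i j).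
  exact: (cvgM cF cF).
- move=> s sT.
  have -> : e = \sum_i \sum_j ((fun s => F s i j) : R -> R^o) ^+ 2.
    apply/funext => x; rewrite /e fct_sumE; apply: eq_bigr => i _.
    by rewrite fct_sumE; apply: eq_bigr => j _.
  apply: is_derive_sum => i; apply: is_derive_sum => j.
  have sT' : s \in `[0, T] by exact: subset_itv_oo_cc.
  have dFij := deriv_within_is_derive sT (deriv_within_entry (dF s sT') i j).
  by apply: is_derive_eq; rewrite /GRing.scale/=; ring.
- move=> s /subset_itv_oo_cc sT.
  (* Each product [F s i j * F' s i j] is at most [L] times the squared norm, and there are [m * n]
     of them. *)
  apply: le_trans (_ : _ <= (m * n)%:R * (2 * (L * `|F s| ^+ 2))) _.
    apply: ler_sum2_cst => i j.
    rewrite ler_wpM2l//; apply: le_trans (ler_norm _) _; rewrite normrM.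
    rewrite expr2 mulrCA ler_pM//; first exact: ler_mx_entry.
    by apply: le_trans (LP s sT); exact: ler_mx_entry.
  rewrite -!mulrA ler_wpM2l// ler_wpM2l// ler_wpM2l//.
  exact: mx_norm_sqr_le.
- by rewrite /e F0 big1// => i _; rewrite big1// => j _; rewrite mxE expr0n.
Qed.
End ode.

(** * Local Lipschitz bounds along paths and for Jacobians *)

Section lipschitz.
Context {R : realType}.

Lemma locally_lipschitzE (V W : normedModType R) (h : V -> W) (z : V) :
  locally_lipschitz h -> exists L, 0 <= L /\ exists2 N : set V, nbhs z N &
    forall x y, N x -> N y -> `|h x - h y| <= L * `|x - y|.
Proof.
(* The Lipschitz notation provides a threshold [M] above which every constant works; [|M| + 1] lies
   above it and is nonnegative. *)
move=> /(_ z)[N zN [M [_ MP]]]; exists (`|M| + 1); split; first exact: addr_ge0.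
exists N => // x y Nx Ny; apply: (MP (`|M| + 1) _ (x, y)) => //=.
by rewrite (le_lt_trans (ler_norm _))// ltrDl.
Qed.

(** With equal limits both paths end up in one Lipschitz neighbourhood. With distinct limits their
    distance stays away from zero while [h] stays bounded along them, so a large constant works.
    Both cases arise, since the two paths are not yet known to coincide. *)
Lemma lipschitz_along (V W : normedModType R) (h : V -> W) (T : Type)
    (F : set_system T) {FF : Filter F} (z1 z2 : T -> V) (y1 y2 : V) :
  locally_lipschitz h -> z1 s @[s --> F] --> y1 -> z2 s @[s --> F] --> y2 ->
  exists L, \forall s \near F, `|h (z1 s) - h (z2 s)| <= L * `|z1 s - z2 s|.
Proof.
move=> hL z1y z2y; have [y12|y12] := eqVneq y1 y2.
  have [L [_ [N zN NL]]] := locally_lipschitzE y1 hL.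
  exists L; near=> s; apply: NL; near: s; first exact: z1y.
  by rewrite y12 in zN; exact: z2y.
have hc y : {for y, continuous h}.
  have [L [L0 [N zN NL]]] := locally_lipschitzE y hL.
  apply/cvgrPdist_le => e e0; near=> x.
  apply: le_trans (NL y x _ _) _; [exact: nbhs_singleton|by near: x|].
  (* [L] may be zero, so the division is by [L + 1]. *)
  have -> : e = (L + 1) * (e / (L + 1)) by rewrite mulrC divfK// gt_eqF// ltr_wpDl.
  apply: ler_pM => //; first by rewrite lerDl.
  near: x; have /cvgrPdist_le := @cvg_id _ (nbhs y); apply.
  by rewrite divr_gt0// ltr_wpDl.
pose d := `|y1 - y2|; have d0 : 0 < d by rewrite normr_gt0 subr_eq0.
(* The numerator eventually bounds the distance of the images, and [d / 2] is eventually a lower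
   bound for the distance of the paths. *)
exists ((`|h y1 - h y2| + 1) / (d / 2)); near=> s.
apply: (@le_trans _ _ (`|h y1 - h y2| + 1)).
  near: s; apply: (cvgr_norm_le (h y1 - h y2)); last by rewrite ltrDl.
  by apply: cvgB; apply: continuous_cvg => //; exact: hc.
rewrite -mulrA ler_peMr ?addr_ge0// mulrC ler_pdivlMr ?divr_gt0// mul1r.
near: s; apply: (cvgr_norm_ge (y1 - y2)); first exact: cvgB.
by rewrite -/d ltr_pdivrMr// ltr_pMr// ltr1n.
Unshelve. all: end_near. Qed.

Lemma derive_lipschitz_le (V W : normedModType R) (h : V -> W) (z v : V) L :
  derivable h z v ->
  (\forall x \near z, `|h x - h z| <= L * `|x - z|) ->
  `|'D_v h z| <= L * `|v|.
Proof.
move=> dh hL.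
have /(_ _) c := cvg_norm (dh : _ --> _).
rewrite /derive -(cvg_lim _ c)//; apply: limr_le.
  by apply/cvg_ex; eexists; exact: c.
have hz : (k *: v + z) @[k --> 0^'] --> z.
  rewrite -[X in _ --> X]add0r -(scale0r v); apply: cvgD; last exact: cvg_cst.
  by apply: cvgZl; exact: cvg_within.
near=> k; have k0 : k != 0 by near: k; rewrite near_withinE; apply: filterE => ?.
have : `|h (k *: v + z) - h z| <= L * `|k *: v + z - z|.
  near: k; exact: hz hL.
rewrite addrK !normrZ normfV mulrCA ler_pdivrMl ?normr_gt0//.
Unshelve. all: end_near. Qed.

(** The entrywise maximum norm is not submultiplicative in general; the factor [n] counts the
    products summed in one entry. *)
Lemma mulmx_norm_le m n p (M : 'M[R]_(m, n)) (N : 'M[R]_(n, p)) :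
  `|M *m N| <= n%:R * (`|M| * `|N|).
Proof.
rewrite [leLHS]/Num.Def.normr/= mx_normrE; apply/bigmax_leP; split=> [|[i j] _].
  by rewrite !mulr_ge0.
rewrite mxE (le_trans (ler_norm_sum _ _ _))//=.
have cn := card_ord n; rewrite mulr_natl -[X in _ *+ X]cn -sumr_const.
by apply: ler_sum => k _; rewrite normrM ler_pM// ler_mx_entry.
Qed.

(** The columns of the Jacobian are derivatives along coordinate vectors of norm at most one, so a
    local Lipschitz constant bounds them at all points near [z]. *)
Lemma jacobian_locally_bounded m n (h : 'cV[R]_n -> 'cV[R]_m) (z : 'cV[R]_n) :
  locally_lipschitz h -> (forall x, differentiable h x) ->
  exists L, 0 <= L /\ \forall x \near z, `|jacobian_cV h x| <= L.
Proof.
move=> hL dh; have [L [L0 [N zN NL]]] := locally_lipschitzE z hL.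
exists L; split => //; near=> x.
rewrite [leLHS]/Num.Def.normr/= mx_normrE; apply/bigmax_leP; split=> [//|[i j] _].
rewrite mxE; apply: le_trans (ler_mx_entry _ _ _) _.
apply: le_trans (derive_lipschitz_le (L := L) _ _) _.
- exact: diff_derivable.
(* A point close to [z] lies in the interior of [N], so [N] is a neighbourhood of that point too. *)
- have : \forall y \near x, N y.
    by near: x; exact: (nbhs_interior zN).
  apply: filterS => y Ny; apply: NL => //.
  near: x; exact: zN.
- rewrite ler_piMr// [leLHS]/Num.Def.normr/= mx_normrE; apply/bigmax_leP.
  split=> // -[k l] _ /=; rewrite mxE.
  by case: (_ && _); rewrite ?normr1 ?normr0.
Unshelve. all: end_near. Qed.

End lipschitz.

(** * Uniqueness of the control-free blocks *)

Section uniqueness.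
Context {R : realType} {nx nu nz nw : nat} {I : Type}.
Variable P : scp_data R nx nu nz nw I.
Let T := horizon P.

(** The difference of the two solutions starts at zero, and [lipschitz_along] supplies the local
    rate bound that [ode_vanish] requires. *)
Lemma nominal_dynamics_unique u1 u2 S1 S2 :
  locally_lipschitz (drift P) ->
  nominal_dynamics P u1 S1 -> nominal_dynamics P u2 S2 ->
  forall t, t \in `[0, T] -> zpart (S1 t) = zpart (S2 t).
Proof.
move=> muL [_ Z10 D1] [_ Z20 D2] t tT; apply/eqP; rewrite -subr_eq0; apply/eqP.
apply: (@ode_vanish _ T _ _ (fun t => zpart (S1 t) - zpart (S2 t))
  (fun t => drift P (zpart (S1 t)) - drift P (zpart (S2 t)))) tT.
- by rewrite Z10 Z20 subrr.
- move=> s sT; have [[_ _ d1] [_ _ d2]] := (D1 s sT, D2 s sT).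
  have := deriv_within_comb 1 (-1) d1 d2; rewrite scale1r scaleN1r.
  by under [X in deriv_within _ X]eq_fun do rewrite scale1r scaleN1r.
- move=> s sT; have [[_ _ d1] [_ _ d2]] := (D1 s sT, D2 s sT).
  exact: lipschitz_along muL (deriv_within_cvg d1) (deriv_within_cvg d2).
Qed.

(** On the shared nominal path the difference solves one linear equation, whose coefficient is
    bounded near each time because the path is continuous. *)
Lemma linearized_dynamics_unique u1 u2 S1 S2 Sh1 Sh2 :
  locally_lipschitz (drift P) -> (forall z, differentiable (drift P) z) ->
  nominal_dynamics P u1 S1 ->
  (forall t, t \in `[0, T] -> zpart (S1 t) = zpart (S2 t)) ->
  linearized_dynamics P u1 S1 Sh1 -> linearized_dynamics P u2 S2 Sh2 ->
  forall t, t \in `[0, T] -> zpart (Sh1 t) = zpart (Sh2 t).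
Proof.
move=> muL mud [_ _ N1] Z12 [_ Z10 D1] [_ Z20 D2] t tT.
apply/eqP; rewrite -subr_eq0; apply/eqP.
apply: (@ode_vanish _ T _ _ (fun t => zpart (Sh1 t) - zpart (Sh2 t))
  (fun t => jacobian_cV (drift P) (zpart (S1 t)) *m
    (zpart (Sh1 t) - zpart (Sh2 t)))) tT.
- by rewrite Z10 Z20 subrr.
- move=> s sT; have [[_ _ d1] [_ _ d2]] := (D1 s sT, D2 s sT).
  have := deriv_within_comb 1 (-1) d1 d2; rewrite scale1r scaleN1r.
  rewrite -Z12// -mulmxBr.
  by under [X in deriv_within _ X]eq_fun do rewrite scale1r scaleN1r.
- move=> s sT; have [_ _ d1] := N1 s sT.
  have [L [L0 LP]] := jacobian_locally_bounded (zpart (S1 s)) muL mud.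
  exists (nz%:R * L).
  have : \forall r \near within `[0, T] (nbhs s),
    `|jacobian_cV (drift P) (zpart (S1 r))| <= L := deriv_within_cvg d1 LP.
  apply: filterS => r rL; apply: le_trans (mulmx_norm_le _ _) _.
  by rewrite -mulrA ler_wpM2l// ler_wpM2r.
Qed.

End uniqueness.

(** * Integrals of matrix-valued functions *)

Section integrals.
Context {R : realType}.
Local Notation leb := (@lebesgue_measure R).
Variable D : set R.
Hypothesis mD : measurable (D : set (measurableTypeR R)).
Implicit Types f g h : R -> R.

Lemma integrable_onD f g : integrable_on D f -> integrable_on D g ->
  integrable_on D (fun t => f t + g t).
Proof. by move=> df dg; have := integrableD mD df dg; exact: eq_integrable. Qed.

Lemma integrable_onZ k f : integrable_on D f -> integrable_on D (fun t => k * f t).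
Proof. move=> df; have := integrableZl mD k df; exact: eq_integrable. Qed.

Lemma integrable_on_sum (J : Type) (r : seq J) (f : J -> R -> R) :
  (forall j, integrable_on D (f j)) ->
  integrable_on D (fun t => \sum_(j <- r) f j t).
Proof.
move=> df; elim: r => [|j r IH].
  by under eq_fun do rewrite big_nil; exact: integrable0.
by under eq_fun do rewrite big_cons; exact: integrable_onD.
Qed.

Lemma integrable_on_eq f g : {in D, f =1 g} -> integrable_on D f ->
  integrable_on D g.
Proof. by move=> fg; apply: eq_integrable => // t tD /=; rewrite fg. Qed.

Lemma integrable_on_le f g : measurable_fun (D : set (measurableTypeR R)) f ->
  (forall t, D t -> `|f t| <= g t) -> integrable_on D g -> integrable_on D f.
Proof.
move=> mf fg; apply: le_integrable => //; first exact/measurable_EFinP.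
by move=> t tD /=; rewrite lee_fin (le_trans (fg t tD))// ler_norm.
Qed.

Lemma integrable_onS (E : set R) f :
  measurable (E : set (measurableTypeR R)) -> E `<=` D ->
  integrable_on D f -> integrable_on E f.
Proof. by move=> mE ED; exact: integrableS. Qed.

Lemma Rintegral_sum (J : Type) (r : seq J) (f : J -> R -> R) :
  (forall j, integrable_on D (f j)) ->
  \int[leb]_(t in D) (\sum_(j <- r) f j t) =
  \sum_(j <- r) \int[leb]_(t in D) f j t.
Proof.
move=> df; elim: r => [|j r IH].
  rewrite big_nil -[RHS](mul0r (fine (leb D))) -Rintegral_cst//.
  by apply: eq_Rintegral => t _; rewrite big_nil.
rewrite big_cons -IH -RintegralD//; [|exact: df|exact: integrable_on_sum].
by apply: eq_Rintegral => t _; rewrite big_cons.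
Qed.

Lemma Rintegral_comb a b f g : integrable_on D f -> integrable_on D g ->
  \int[leb]_(t in D) (a * f t + b * g t) =
  a * \int[leb]_(t in D) f t + b * \int[leb]_(t in D) g t.
Proof.
by move=> df dg; rewrite RintegralD ?RintegralZl//; exact: integrable_onZ.
Qed.

End integrals.

(** * Quadratic forms under the integral and Minkowski's inequality *)

Section matrix_integrals.
Context {R : realType}.
Local Notation leb := (@lebesgue_measure R).
Variable D : set R.
Hypothesis mD : measurable (D : set (measurableTypeR R)).

Definition mx_measurable_on p q (M : R -> 'M[R]_(p, q)) :=
  forall i j, measurable_fun (D : set (measurableTypeR R)) (fun s => M s i j).

Lemma mx_measurable_cst p q (M : 'M[R]_(p, q)) : mx_measurable_on (fun=> M).
Proof. by move=> i j; exact: measurable_cst. Qed.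

Lemma mx_measurable_mul p q r (M : R -> 'M[R]_(p, q)) (N : R -> 'M[R]_(q, r)) :
  mx_measurable_on M -> mx_measurable_on N ->
  mx_measurable_on (fun s => M s *m N s).
Proof.
move=> mM mN i j; under eq_fun do rewrite mxE.
by apply: measurable_sum => k; exact: measurable_funM.
Qed.

Lemma mx_measurable_tr p q (M : R -> 'M[R]_(p, q)) :
  mx_measurable_on M -> mx_measurable_on (fun s => (M s)^T).
Proof. by move=> mM i j; under eq_fun do rewrite mxE; exact: mM. Qed.

Lemma mx_measurable_comb p q a b (M N : R -> 'M[R]_(p, q)) :
  mx_measurable_on M -> mx_measurable_on N ->
  mx_measurable_on (fun s => a *: M s + b *: N s).
Proof.
move=> mM mN i j; under eq_fun do rewrite !mxE.
by apply: measurable_funD; apply: measurable_funM => //; exact: measurable_cst.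
Qed.

Lemma mx_measurable_eq p q (M N : R -> 'M[R]_(p, q)) : {in D, M =1 N} ->
  mx_measurable_on M -> mx_measurable_on N.
Proof.
by move=> MN mM i j; apply: eq_measurable_fun (mM i j) => t tD; rewrite MN.
Qed.

Lemma quad_formE n (M : 'M[R]_n) (v : 'cV[R]_n) :
  (v^T *m M *m v) 0 0 = \sum_j \sum_i v j 0 * v i 0 * M i j.
Proof.
rewrite mxE; apply: eq_bigr => j _; rewrite mxE mulr_suml.
by apply: eq_bigr => i _; rewrite mxE; ring.
Qed.

(** For fixed [v] the form is a finite linear combination of entries, so it commutes with the
    entrywise integral. This reduces the Loewner order between integrals to scalar inequalities. *)
Lemma quad_form_integral n (M : R -> 'M[R]_n) (v : 'cV[R]_n) :
  mx_integrable_on D M ->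
  integrable_on D (fun t => (v^T *m M t *m v) 0 0) /\
  (v^T *m mx_integral D M *m v) 0 0 =
  \int[leb]_(t in D) (v^T *m M t *m v) 0 0.
Proof.
move=> iM.
have iF j : integrable_on D (fun t => \sum_i v j 0 * v i 0 * M t i j).
  by apply: integrable_on_sum => // i; exact: integrable_onZ.
split.
  apply: (@integrable_on_eq _ _ _
    (fun t => \sum_j \sum_i v j 0 * v i 0 * M t i j)) => //.
    by move=> t _; rewrite quad_formE.
  exact: integrable_on_sum.
rewrite quad_formE.
under [RHS]eq_Rintegral do rewrite quad_formE.
rewrite Rintegral_sum//; apply: eq_bigr => j _.
rewrite Rintegral_sum//; last by move=> i; exact: integrable_onZ.
by apply: eq_bigr => i _; rewrite mxE RintegralZl//; exact: iM.
Qed.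

(** The squared Euclidean norm, as opposed to the maximum norm on matrices. The trace in the chance
    constraint takes this form. *)
Definition sqnorm n (w : 'rV[R]_n) : R := \sum_k w 0 k ^+ 2.

Lemma sqnorm_ge0 n (w : 'rV[R]_n) : 0 <= sqnorm w.
Proof. by apply: sumr_ge0 => k _; exact: sqr_ge0. Qed.

Lemma sqnormE n (w : 'rV[R]_n) : sqnorm w = (w *m w^T) 0 0.
Proof. by rewrite mxE; apply: eq_bigr => k _; rewrite mxE. Qed.

(* In the application the weights [x], [y] are the two L2 norms. *)
Lemma sqnorm_comb_le n (w1 w2 : 'rV[R]_n) a b x y : 0 <= a -> 0 <= b ->
  0 < x -> 0 < y -> sqnorm (a *: w1 + b *: w2) <=
  (a * x + b * y) * (a / x * sqnorm w1 + b / y * sqnorm w2).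
Proof.
move=> a0 b0 x0 y0; rewrite /sqnorm !mulr_sumr -big_split/= mulr_sumr.
apply: ler_sum => k _; rewrite !mxE -subr_ge0.
have -> : (a * x + b * y) * (a / x * w1 0 k ^+ 2 + b / y * w2 0 k ^+ 2) -
    (a * w1 0 k + b * w2 0 k) ^+ 2 =
  a * b * (x * y)^-1 * (y * w1 0 k - x * w2 0 k) ^+ 2.
  by field; rewrite !gt_eqF.
by rewrite mulr_ge0 ?sqr_ge0// mulr_ge0 ?invr_ge0 ?mulr_ge0// ltW.
Qed.

(** Integrating [sqnorm_comb_le] with constant weights [x] and [y] close to the two L2 norms bounds
    the integral by the square of [a * x + b * y]. *)
Lemma minkowski_sqnorm n (w1 w2 : R -> 'rV[R]_n) (a b : R) :
  0 <= a -> 0 <= b -> a + b = 1 ->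
  mx_measurable_on w1 -> mx_measurable_on w2 ->
  integrable_on D (fun s => sqnorm (w1 s)) ->
  integrable_on D (fun s => sqnorm (w2 s)) ->
  integrable_on D (fun s => sqnorm (a *: w1 s + b *: w2 s)) /\
  Num.sqrt (\int[leb]_(s in D) sqnorm (a *: w1 s + b *: w2 s)) <=
  a * Num.sqrt (\int[leb]_(s in D) sqnorm (w1 s)) +
  b * Num.sqrt (\int[leb]_(s in D) sqnorm (w2 s)).
Proof.
move=> a0 b0 ab m1 m2 i1 i2.
have iB x y : integrable_on D (fun s =>
    (a * x + b * y) * (a / x * sqnorm (w1 s) + b / y * sqnorm (w2 s))).
  by apply: integrable_onZ => //; apply: integrable_onD => //; exact: integrable_onZ.
have iw : integrable_on D (fun s => sqnorm (a *: w1 s + b *: w2 s)).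
  apply: integrable_on_le (iB 1 1) => //.
    apply: measurable_sum => k; apply: measurable_funX.
    exact: mx_measurable_comb.
  by move=> t _; rewrite ger0_norm ?sqnorm_ge0// sqnorm_comb_le.
(* The slack [e] keeps the weights positive when an L2 norm vanishes; it is recovered exactly
   because [a + b = 1]. *)
split=> //; apply/ler_addgt0Pr => e e0.
set A := \int[leb]_(s in D) sqnorm (w1 s); set B := \int[leb]_(s in D) sqnorm (w2 s).
have A0 : 0 <= A by apply: Rintegral_ge0 => s _; exact: sqnorm_ge0.
have B0 : 0 <= B by apply: Rintegral_ge0 => s _; exact: sqnorm_ge0.
pose x := Num.sqrt A + e; pose y := Num.sqrt B + e.
have x0 : 0 < x by rewrite ltr_wpDl// sqrtr_ge0.
have y0 : 0 < y by rewrite ltr_wpDl// sqrtr_ge0.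
have -> : a * Num.sqrt A + b * Num.sqrt B + e = a * x + b * y.
  by rewrite /x /y -[in LHS](mulr1 e) -ab; ring.
have c0 : 0 <= a * x + b * y by rewrite addr_ge0// mulr_ge0// ltW.
rewrite -[leRHS]ger0_norm// -sqrtr_sqr ler_wsqrtr//.
apply: (le_trans (le_Rintegral mD iw (iB x y) _)).
  by move=> s _; exact: sqnorm_comb_le.
rewrite RintegralZl//; last by apply: integrable_onD => //; exact: integrable_onZ.
(* Since [x] is at least the square root of [A], the quotient [A / x] is at most [x]; likewise for
   [B] and [y]. *)
rewrite Rintegral_comb// -/A -/B expr2 ler_wpM2l// lerD//.
  rewrite -mulrA ler_wpM2l// ler_pdivrMl// -[A]sqr_sqrtr// -expr2.
  by rewrite lerXn2r ?nnegrE ?sqrtr_ge0 ?(ltW x0)// lerDl ltW.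
rewrite -mulrA ler_wpM2l// ler_pdivrMl// -[B]sqr_sqrtr// -expr2.
by rewrite lerXn2r ?nnegrE ?sqrtr_ge0 ?(ltW y0)// lerDl ltW.
Qed.

End matrix_integrals.

(** * Convex quadratic functions *)

Section quadratic.
Context {R : realType} {n : nat}.
Implicit Types (x y v : 'cV[R]_n) (f : 'cV[R]_n -> R).

Definition quadratic c (b : 'I_n -> R) (a : 'I_n -> 'I_n -> R) x : R :=
  c + \sum_i b i * x i 0 + \sum_i \sum_j a i j * (x i 0 * x j 0).

Lemma is_derive_coord i x v :
  is_derive x v (fun y : 'cV[R]_n => y i 0 : R^o) (v i 0).
Proof.
have c : h^-1 *: ((h *: v + x) i 0 - x i 0 : R^o) @[h --> 0^'] --> (v i 0 : R^o).
  apply: cvg_near_cst; near=> h; rewrite !mxE addrK [_ *: _]mulrA mulVf ?mul1r//.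
  by near: h; rewrite near_withinE; apply: filterE.
by apply: DeriveDef; [apply/cvg_ex; exists (v i 0)|exact: cvg_lim c].
Unshelve. all: end_near. Qed.

Lemma is_derive_quadratic c b a x v :
  is_derive x v (quadratic c b a : _ -> R^o) (\sum_i b i * v i 0 +
    \sum_i \sum_j a i j * (x i 0 * v j 0 + x j 0 * v i 0)).
Proof.
pose crd i : 'cV[R]_n -> R^o := fun y => y i 0.
have -> : quadratic c b a = cst c + \sum_i (b i \*: crd i) +
    \sum_i \sum_j (a i j \*: (crd i * crd j)) :> ('cV[R]_n -> R^o).
  apply/funext => y; rewrite /quadratic !fctE !fct_sumE; congr (_ + _ + _).
  by apply: eq_bigr => i _; rewrite fct_sumE.
have dc i := is_derive_coord i x v : is_derive x v (crd i) _.
rewrite -[\sum_i b i * v i 0]add0r.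
refine (is_deriveD (is_deriveD (is_derive_cst _ _ _) _) _).
apply: is_derive_sum => i; apply: is_derive_sum => j.
by apply: (is_derive_eq (is_deriveZ (a i j) (is_deriveM (dc i) (dc j)))).
Qed.

Lemma sum_delta_cV (f : 'I_n -> R) j :
  \sum_i f i * (delta_mx j 0 : 'cV[R]_n) i 0 = f j.
Proof.
rewrite (bigD1 j)//= mxE !eqxx mulr1 big1 ?addr0// => i ij.
by rewrite mxE (negPf ij) mulr0.
Qed.

(** The coefficients need not be symmetric, whence the sum of [a i j] and [a j i]. A first partial
    derivative is again [quadratic], with zero second-order part, so the same derivative formula
    applies twice. *)
Lemma hessian_quadratic c b a x :
  hessian (quadratic c b a) x = \matrix_(i, j) (a i j + a j i).
Proof.
apply/matrixP => i j; rewrite !mxE.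
have -> : (fun y => 'D_(delta_mx j 0) (quadratic c b a : _ -> R^o) y) =
    quadratic (b j) (fun k => a j k + a k j) (fun _ _ => 0).
  apply/funext => y.
  rewrite (@derive_val _ _ _ _ _ _ _ (is_derive_quadratic _ _ _ _ _)).
  rewrite sum_delta_cV /quadratic [X in _ = _ + X]big1 ?addr0; last first.
    by move=> k _; rewrite big1// => l _; rewrite mul0r.
  congr (_ + _).
  have -> : \sum_k \sum_l a k l * (y k 0 * (delta_mx j 0 : 'cV[R]_n) l 0 +
      y l 0 * (delta_mx j 0 : 'cV[R]_n) k 0) =
    \sum_k (a k j * y k 0) + \sum_l (a j l * y l 0).
    rewrite -[X in _ = _ + X](sum_delta_cV (fun k => \sum_l a k l * y l 0)).
    rewrite -big_split/=; apply: eq_bigr => k _.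
    rewrite -[X in _ = X + _](sum_delta_cV (fun l => a k l * y k 0)).
    rewrite mulr_suml -big_split/=; apply: eq_bigr => l _; ring.
  by rewrite addrC -big_split/=; apply: eq_bigr => k _; rewrite mulrDl.
rewrite (@derive_val _ _ _ _ _ _ _ (is_derive_quadratic _ _ _ _ _)).
rewrite sum_delta_cV big1 ?addr0 1?addrC// => k _.
by rewrite big1// => l _; rewrite mul0r.
Qed.

(** Constant and linear terms cancel because [p + q = 1]; the second-order part leaves [p * q] times
    itself at [x - y], which is half the Hessian form. *)
Lemma quadratic_convexity_gap c b a x y p q : p + q = 1 ->
  p * quadratic c b a x + q * quadratic c b a y -
    quadratic c b a (p *: x + q *: y) =
  p * q / 2 * ((x - y)^T *m (\matrix_(i, j) (a i j + a j i)) *m (x - y)) 0 0.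
Proof.
move=> pq; have -> : q = 1 - p by rewrite -pq addrC addKr.
rewrite quad_formE.
have -> : \sum_j \sum_i (x - y) j 0 * (x - y) i 0 *
    (\matrix_(k, l) (a k l + a l k)) i j =
  2 * \sum_i \sum_j a i j * ((x - y) i 0 * (x - y) j 0).
  rewrite mulr_natl mulr2n [X in _ = X + _]exchange_big -big_split/=.
  apply: eq_bigr => i _; rewrite -big_split/=; apply: eq_bigr => j _.
  by rewrite [(\matrix_(_, _) _) _ _]mxE; ring.
rewrite mulrA divfK ?pnatr_eq0// /quadratic.
have -> : \sum_i b i * (p *: x + (1 - p) *: y) i 0 =
    p * (\sum_i b i * x i 0) + (1 - p) * (\sum_i b i * y i 0).
  rewrite !mulr_sumr -big_split; apply: eq_bigr => i _ /=; rewrite !mxE; ring.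
have -> : p * (1 - p) * (\sum_i \sum_j a i j * ((x - y) i 0 * (x - y) j 0)) =
  p * (\sum_i \sum_j a i j * (x i 0 * x j 0)) +
  (1 - p) * (\sum_i \sum_j a i j * (y i 0 * y j 0)) -
  \sum_i \sum_j a i j *
    ((p *: x + (1 - p) *: y) i 0 * (p *: x + (1 - p) *: y) j 0).
  rewrite !mulr_sumr -big_split -sumrB /=; apply: eq_bigr => i _.
  rewrite !mulr_sumr -big_split -sumrB /=; apply: eq_bigr => j _.
  rewrite !mxE; ring.
ring.
Qed.

Lemma quadratic_continuous c b a : continuous (quadratic c b a : _ -> R^o).
Proof.
move=> x; pose crd i : 'cV[R]_n -> R^o := fun y => y i 0.
have cx i : crd i y @[y --> x] --> crd i x by exact: coord_continuous.
have h1 : \sum_i (b i : R^o) * crd i y @[y --> x] --> \sum_i b i * crd i x.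
  by apply: (@cvg_sumr _ _ (nbhs x)) => i; exact: (cvgM (cvg_cst (b i)) (cx i)).
have h2 : \sum_i \sum_j (a i j : R^o) * (crd i y * crd j y) @[y --> x] -->
    \sum_i \sum_j a i j * (crd i x * crd j x).
  apply: (@cvg_sumr _ _ (nbhs x)) => i; apply: (@cvg_sumr _ _ (nbhs x)) => j.
  exact: (cvgM (cvg_cst (a i j)) (cvgM (cx i) (cx j))).
exact: (cvgD (cvgD (cvg_cst (c : R^o)) h1) h2).
Qed.

Lemma degree_le2_continuous f : degree_le2 f -> continuous f.
Proof.
move=> [c [b [a fE]]]; rewrite (_ : f = quadratic c b a); last exact/funext.
exact: quadratic_continuous.
Qed.

Lemma convex_functionE f p q x y : @convex_function R 'cV[R]_n setT f ->
  0 <= p -> 0 <= q -> p + q = 1 -> f (p *: x + q *: y) <= p * f x + q * f y.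
Proof.
move=> cf p0 q0 pq; have p1 : p <= 1 by rewrite -pq lerDl.
have -> : q = 1 - p by rewrite -pq addrC addKr.
by have := cf (Itv01 p0 p1) x y (mem_setT _) (mem_setT _).
Qed.

(** Midpoint convexity between [v] and [0] suffices: the gap is then a positive multiple of the
    Hessian form at [v]. *)
Lemma convex_degree_le2_hessian f : degree_le2 f ->
  @convex_function R 'cV[R]_n setT f ->
  exists2 H : 'M[R]_n, psd H & forall x, hessian f x = H.
Proof.
move=> [c [b [a fE]]] cf; have {fE}fE : f = quadratic c b a by exact/funext.
exists (\matrix_(i, j) (a i j + a j i)); last first.
  by move=> x; rewrite fE hessian_quadratic.
split=> [|v]; first by apply/matrixP => i j; rewrite !mxE addrC.
have h : 2^-1 + 2^-1 = 1 :> R by lra.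
have h0 : 0 <= 2^-1 :> R by rewrite invr_ge0.
have := convex_functionE v 0 cf h0 h0 h.
by rewrite -subr_ge0 fE quadratic_convexity_gap// subr0 pmulr_rge0.
Qed.

Lemma psd_convex (H : 'M[R]_n) p q x y : psd H -> 0 <= p -> 0 <= q -> p + q = 1 ->
  ((p *: x + q *: y)^T *m H *m (p *: x + q *: y)) 0 0 <=
  p * (x^T *m H *m x) 0 0 + q * (y^T *m H *m y) 0 0.
Proof.
move=> [HT H0] p0 q0 pq; rewrite -subr_ge0.
have -> : p * (x^T *m H *m x) 0 0 + q * (y^T *m H *m y) 0 0 -
    ((p *: x + q *: y)^T *m H *m (p *: x + q *: y)) 0 0 =
    p * q * ((x - y)^T *m H *m (x - y)) 0 0.
  have -> : q = 1 - p by rewrite -pq addrC addKr.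
  rewrite !quad_formE !mulr_sumr -big_split -sumrB; apply: eq_bigr => j _ /=.
  rewrite !mulr_sumr -big_split -sumrB; apply: eq_bigr => i _ /=.
  rewrite !mxE; ring.
by rewrite !mulr_ge0.
Qed.

End quadratic.

(** * Measurability and integrability along continuous paths *)

Section trajectories.
Context {R : realType}.
Variable D : set R.
Hypothesis mD : measurable (D : set (measurableTypeR R)).

Definition cont_within (V : topologicalType) (F : R -> V) :=
  forall t, D t -> F s @[s --> within D (nbhs t)] --> F t.

Lemma cont_within_measurable (f : R -> R) :
  cont_within f -> measurable_fun (D : set (measurableTypeR R)) f.
Proof.
by move=> cf; apply: subspace_continuous_measurable_fun => //;
  apply/subspace_continuousP.
Qed.

Lemma cont_within_integrable (f : R -> R) : compact D ->
  cont_within f -> integrable_on D f.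
Proof.
by move=> cD cf; apply: continuous_compact_integrable => //;
  apply/subspace_continuousP.
Qed.

Lemma cont_within_comp (V W : topologicalType) (h : V -> W) (F : R -> V) :
  continuous h -> cont_within F -> cont_within (h \o F).
Proof. by move=> ch cF t Dt; exact: (cvg_comp _ _ (cF t Dt) (ch _)). Qed.

Lemma cont_within_mx_measurable p q (F : R -> 'M[R]_(p, q)) :
  cont_within F -> mx_measurable_on D F.
Proof.
move=> cF i j; apply: cont_within_measurable.
apply: (@cont_within_comp _ _ (fun M : 'M[R]_(p, q) => M i j)) => //.
exact: coord_continuous.
Qed.

(** The derivative of a merely differentiable [u] may be discontinuous. Along the path it is the
    pointwise limit of the difference quotients with steps [harmonic k], each continuous in time. *)
Lemma derive_along_measurable p q n (u : 'cV[R]_n -> 'M[R]_(p, q)) v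
    (Z : R -> 'cV[R]_n) :
  (forall z, differentiable u z) -> cont_within Z ->
  mx_measurable_on D (fun s => 'D_v u (Z s)).
Proof.
move=> du cZ i j.
have cu : continuous u by move=> z; exact: differentiable_continuous.
pose quo (k : nat) (z : 'cV[R]_n) : 'M[R]_(p, q) :=
  (harmonic k)^-1 *: (u (harmonic k *: v + z) - u z).
apply: (@measurable_fun_cvg _ _ _ _ (fun k s => quo k (Z s) i j)).
  move=> k; apply: cont_within_mx_measurable.
  apply: (@cont_within_comp _ _ (quo k)) => // z.
  have h1 : u (harmonic k *: v + y) @[y --> z] --> u (harmonic k *: v + z).
    by apply: (cvg_comp _ u _ (cu _)); exact: (cvgD (cvg_cst _) cvg_id).
  exact: (@cvgZl_tmp _ _ _ (nbhs z) _ _ _ _ (cvgB h1 (cu z))).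
move=> s Ds.
have c : quo k (Z s) @[k --> \oo] --> 'D_v u (Z s).
  have dZ : derivable u (Z s) v by exact: diff_derivable.
  have h0 : harmonic k @[k --> \oo] --> (0 : R)^'.
    move=> P /nbhs_ballP[e /= e0 eP].
    have /cvgrPdist_lt/(_ e e0) := @cvg_harmonic R; apply: filterS => k kP.
    by apply: eP => //=; rewrite gt_eqF// harmonic_gt0.
  exact: (cvg_comp _ _ h0 dZ).
exact: (cvg_comp _ _ c (@coord_continuous _ _ _ i j _)).
Qed.

Lemma jacobian_along_measurable m n (u : 'cV[R]_n -> 'cV[R]_m)
    (Z : R -> 'cV[R]_n) :
  (forall z, differentiable u z) -> cont_within Z ->
  mx_measurable_on D (fun s => jacobian_cV u (Z s)).
Proof.
move=> du cZ i j; under eq_fun do rewrite mxE.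
exact: (derive_along_measurable (delta_mx j 0) du cZ).
Qed.

(** Preimages of open sets under [Z] are relatively open in [D], hence measurable, so [Z] is
    measurable into the Borel sets and composes with [h]. *)
Lemma borel_along_measurable n p q (h : 'cV[R]_n -> 'M[R]_(p, q))
    (Z : R -> 'cV[R]_n) :
  borel_matrix h -> cont_within Z -> mx_measurable_on D (h \o Z).
Proof.
move=> bh cZ i j.
have mZ : measurable_fun (D : set (measurableTypeR R))
    (Z : R -> g_sigma_algebraType (@open 'cV[R]_n)).
  apply: (@measurability _ _ (measurableTypeR R)
    (g_sigma_algebraType (@open 'cV[R]_n)) D Z (@open 'cV[R]_n) erefl).
  move=> _ [U oU <-]; apply: open_measurable_subspace => //.
  have cZ' : {within D, continuous Z} by apply/subspace_continuousP.
  by move/continuousP : cZ'; exact.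
exact: (measurableT_comp (bh i j) mZ).
Qed.

End trajectories.

(** * Positive semidefinite matrices *)

Section psd.
Context {R : realType}.

Lemma cvg_mx (T : Type) (F : set_system T) {FF : Filter F} p q
    (M : T -> 'M[R]_(p, q)) (L : 'M[R]_(p, q)) :
  (forall i j, M s i j @[s --> F] --> L i j) -> M s @[s --> F] --> L.
Proof.
move=> ML; apply/cvgrPdist_le => e e0; near=> s.
rewrite [leLHS]/Num.Def.normr/= mx_normrE (bigmax_le _ (ltW e0))//= => i _.
rewrite !mxE; move: i; near: s; apply: filter_forall => -[i j] /=.
by have /cvgrPdist_le := ML i j; apply.
Unshelve. all: end_near. Qed.

Lemma form_mulmx m n (S : 'M[R]_(m, n)) (H : 'M[R]_m) (v : 'cV[R]_n) :
  v^T *m (S^T *m H *m S) *m v = (S *m v)^T *m H *m (S *m v).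
Proof. by rewrite trmx_mul !mulmxA. Qed.

Lemma psd_mulmx m n (S : 'M[R]_(m, n)) (H : 'M[R]_m) :
  psd H -> psd (S^T *m H *m S).
Proof.
move=> [HT H0]; split; first by rewrite !trmx_mul trmxK HT mulmxA.
by move=> v; rewrite form_mulmx.
Qed.

Lemma form_delta n (M : 'M[R]_n) i j :
  ((delta_mx i 0 : 'cV[R]_n)^T *m M *m (delta_mx j 0 : 'cV[R]_n)) 0 0 = M i j.
Proof. by rewrite trmx_delta -rowE -colE !mxE. Qed.

(** The form is tested at the sum and the difference of two coordinate vectors. Dominating a psd
    matrix entry by entry thus reduces to its diagonal. *)
Lemma psd_entry_le n (M : 'M[R]_n) i j : psd M ->
  `|M i j| <= 2^-1 * (M i i + M j j).
Proof.
move=> [MT M0]; pose d k : 'cV[R]_n := delta_mx k 0.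
have Mji : M j i = M i j by rewrite -[in LHS]MT mxE.
have E (c : R) : ((d i + c *: d j)^T *m M *m (d i + c *: d j)) 0 0 =
    M i i + c * (M i j + M j i) + c ^+ 2 * M j j.
  rewrite [(_ + _)^T]raddfD/= [(_ *: _)^T]linearZ/= !mulmxDl !mulmxDr.
  rewrite -!scalemxAl -!scalemxAr.
  have Add (A B : 'M[R]_1) : (A + B) 0 0 = A 0 0 + B 0 0 by rewrite mxE.
  have Scl k (A : 'M[R]_1) : (k *: A) 0 0 = k * A 0 0 by rewrite mxE.
  by rewrite !(Add, Scl) !form_delta; ring.
have := M0 (d i + 1 *: d j); have := M0 (d i + (-1) *: d j).
by rewrite !E Mji ler_norml => h1 h2; lra.
Qed.

Lemma psd_form_convex m n (H : 'M[R]_m) (S1 S2 : 'M[R]_(m, n)) a b (v : 'cV[R]_n) :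
  psd H -> 0 <= a -> 0 <= b -> a + b = 1 ->
  let S := a *: S1 + b *: S2 in
  (v^T *m (S^T *m H *m S) *m v) 0 0 <=
  a * (v^T *m (S1^T *m H *m S1) *m v) 0 0 +
  b * (v^T *m (S2^T *m H *m S2) *m v) 0 0.
Proof.
move=> pH a0 b0 ab /=; rewrite !form_mulmx mulmxDl -!scalemxAl.
exact: psd_convex.
Qed.

End psd.

(** * Convex combinations of feasible points *)

Section combination.
Context {R : realType} {nx nu nz nw : nat} {I : Type}.
Variable P : scp_data R nx nu nz nw I.
Let T := horizon P.
Hypothesis drift_diff : forall z, differentiable (drift P) z.
Hypothesis drift_lip : locally_lipschitz (drift P).
Local Notation N := (nx + nu + nz)%N.

Variables a b : R.
Hypothesis ab : a + b = 1.

Definition comb (X : Type) (V : lmodType R) (f g : X -> V) : X -> V :=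
  fun x => a *: f x + b *: g x.

Lemma convex_comb_id (V : lmodType R) (x : V) : a *: x + b *: x = x.
Proof. by rewrite -scalerDl ab scale1r. Qed.

Lemma xpart_comb q (A B : 'M[R]_(N, q)) :
  xpart (a *: A + b *: B) = a *: xpart A + b *: xpart B.
Proof. by rewrite /xpart !linearD !linearZ. Qed.

Lemma upart_comb q (A B : 'M[R]_(N, q)) :
  upart (a *: A + b *: B) = a *: upart A + b *: upart B.
Proof. by rewrite /upart !linearD !linearZ. Qed.

Lemma zpart_comb q (A B : 'M[R]_(N, q)) :
  zpart (a *: A + b *: B) = a *: zpart A + b *: zpart B.
Proof. by rewrite /zpart !linearD !linearZ. Qed.

(** Directional derivatives are additive where they exist, which differentiability at [z]
    ensures. *)
Lemma jacobian_comb m n (u1 u2 : 'cV[R]_n -> 'cV[R]_m) z :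
  differentiable u1 z -> differentiable u2 z ->
  jacobian_cV (comb u1 u2) z = a *: jacobian_cV u1 z + b *: jacobian_cV u2 z.
Proof.
move=> d1 d2; apply/matrixP => i j; rewrite !mxE.
have [e1 e2] : derivable u1 z (delta_mx j 0) /\ derivable u2 z (delta_mx j 0).
  by split; exact: diff_derivable.
rewrite (_ : comb u1 u2 = a \*: u1 + b \*: u2)// deriveD; try exact: derivableZ.
by rewrite !deriveZ// !mxE.
Qed.

Lemma subset_horizon t : t \in `[0, T] -> `[0, t] `<=` `[0, T].
Proof.
rewrite in_itv/= => /andP[_ tT] s /=; rewrite !in_itv/= => /andP[-> st] /=.
exact: le_trans tT.
Qed.

Section dynamics.
Variables (u1 u2 : 'cV[R]_nz -> 'cV[R]_nu) (S1 S2 : R -> 'cV[R]_N).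
Variables (Sh1 Sh2 : R -> 'M[R]_(N, nz)).
Hypotheses (du1 : forall z, differentiable u1 z)
  (du2 : forall z, differentiable u2 z).
Hypotheses (nom1 : nominal_dynamics P u1 S1) (nom2 : nominal_dynamics P u2 S2).
Hypotheses (lin1 : linearized_dynamics P u1 S1 Sh1)
  (lin2 : linearized_dynamics P u2 S2 Sh2).
Let S := comb S1 S2.
Let Sh := comb Sh1 Sh2.

Lemma zpart_eq12 t : t \in `[0, T] -> zpart (S1 t) = zpart (S2 t).
Proof. exact: nominal_dynamics_unique nom1 nom2 t. Qed.

Lemma zpart_combE t : t \in `[0, T] -> zpart (S t) = zpart (S1 t).
Proof. by move=> tT; rewrite zpart_comb -zpart_eq12// convex_comb_id. Qed.

Lemma nominal_dynamics_comb : nominal_dynamics P (comb u1 u2) S.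
Proof.
have [[X10 Z10 D1] [X20 Z20 D2]] := (nom1, nom2); split.
- by rewrite xpart_comb X10 X20 convex_comb_id.
- by rewrite zpart_comb Z10 Z20 convex_comb_id.
- move=> t tT; have [U1 dX1 dZ1] := D1 t tT; have [U2 dX2 dZ2] := D2 t tT.
  split.
  + by rewrite upart_comb U1 U2 zpart_combE// /comb zpart_eq12.
  + apply: deriv_within_eq (deriv_within_comb a b dX1 dX2) => //.
      by move=> s _; rewrite xpart_comb.
    rewrite [zpart (S t)]zpart_combE// xpart_comb /comb -zpart_eq12//.
    (* The [matC] term is common to both solutions; it is written as a combination of itself so that
       the three terms regroup. *)
    rewrite !mulmxDr -!scalemxAr !scalerDr -[in RHS](convex_comb_id (_ *m zpart _)).
    by rewrite [LHS]addrACA; congr (_ + _); rewrite [LHS]addrACA.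
  + apply: deriv_within_eq (deriv_within_comb a b dZ1 dZ2) => //.
      by move=> s _; rewrite zpart_comb.
    by rewrite -zpart_eq12// convex_comb_id zpart_combE.
Qed.

Lemma zparth_eq12 t : t \in `[0, T] -> zpart (Sh1 t) = zpart (Sh2 t).
Proof.
exact: linearized_dynamics_unique drift_lip drift_diff nom1 zpart_eq12 lin1 lin2 t.
Qed.

Lemma zparth_combE t : t \in `[0, T] -> zpart (Sh t) = zpart (Sh1 t).
Proof. by move=> tT; rewrite zpart_comb -zparth_eq12// convex_comb_id. Qed.

(** With both [zpart] paths shared, the product of the policy Jacobian and [zpart (Sh t)] depends
    linearly on the policy. *)
Lemma linearized_dynamics_comb : linearized_dynamics P (comb u1 u2) S Sh.
Proof.
have [[X10 Z10 D1] [X20 Z20 D2]] := (lin1, lin2); split.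
- by rewrite xpart_comb X10 X20 convex_comb_id.
- by rewrite zpart_comb Z10 Z20 convex_comb_id.
- move=> t tT; have [U1 dX1 dZ1] := D1 t tT; have [U2 dX2 dZ2] := D2 t tT.
  have [ZE ZhE] := (zpart_combE tT, zparth_combE tT).
  have [Z12 Zh12] := (zpart_eq12 tT, zparth_eq12 tT).
  rewrite ZE (jacobian_comb (du1 _) (du2 _)).
  rewrite -Z12 -Zh12 in U2 dX2 dZ2.
  have JE : (a *: jacobian_cV u1 (zpart (S1 t)) + b *: jacobian_cV u2 (zpart (S1 t)))
      *m zpart (Sh t) = a *: (jacobian_cV u1 (zpart (S1 t)) *m zpart (Sh1 t)) +
      b *: (jacobian_cV u2 (zpart (S1 t)) *m zpart (Sh1 t)).
    by rewrite ZhE mulmxDl -!scalemxAl.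
  split.
  + by rewrite upart_comb U1 U2 JE.
  + apply: deriv_within_eq (deriv_within_comb a b dX1 dX2) => //.
      by move=> s _; rewrite xpart_comb.
    rewrite JE ZhE xpart_comb !mulmxDr -!scalemxAr !scalerDr.
    rewrite -[in RHS](convex_comb_id (matC P *m zpart (Sh1 t))).
    by rewrite [LHS]addrACA; congr (_ + _); rewrite [LHS]addrACA.
  + apply: deriv_within_eq (deriv_within_comb a b dZ1 dZ2) => //.
      by move=> s _; rewrite zpart_comb.
    by rewrite convex_comb_id ZhE.
Qed.

End dynamics.

End combination.

(** * Regularity of trajectories satisfying the dynamics *)

Section trajectory_regularity.
Context {R : realType} {nx nu nz nw : nat} {I : Type}.
Variable P : scp_data R nx nu nz nw I.
Let T := horizon P.
Local Notation N := (nx + nu + nz)%N.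
Variables (u : 'cV[R]_nz -> 'cV[R]_nu) (S : R -> 'cV[R]_N).
Variables (Sh : R -> 'M[R]_(N, nz)).
Hypotheses (du : forall z, differentiable u z).
Hypotheses (nom : nominal_dynamics P u S) (lin : linearized_dynamics P u S Sh).

Lemma blockE q (M : 'M[R]_(N, q)) :
  M = col_mx (col_mx (xpart M) (upart M)) (zpart M).
Proof. by rewrite /xpart /upart /zpart !vsubmxK. Qed.

Lemma nominal_zpart_continuous : cont_within `[0, T] (fun s => zpart (S s)).
Proof.
by have [_ _ D1] := nom; move=> t tT; have [_ _ /deriv_within_cvg] := D1 t tT.
Qed.

(** The [xpart] and [zpart] blocks have derivatives; the control block agrees on the interval with
    [u] along a continuous path. *)
Lemma nominal_continuous : cont_within `[0, T] S.
Proof.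
have [_ _ D1] := nom; move=> t tT; have [U /deriv_within_cvg cX _] := D1 t tT.
have cZ := nominal_zpart_continuous tT.
have cu : u (zpart (S s)) @[s --> within `[0, T] (nbhs t)] --> u (zpart (S t)).
  have cu : continuous u by move=> z; exact: differentiable_continuous.
  exact: (cvg_comp _ u cZ (cu _)).
have cU : upart (S s) @[s --> within `[0, T] (nbhs t)] --> upart (S t).
  rewrite U; apply: cvg_trans cu; apply: near_eq_cvg.
  near=> s; have sT : s \in `[0, T] by near: s; exact: withinT.
  by have [-> _ _] := D1 s sT.
have entry m n (F : R -> 'M[R]_(m, n)) (L : 'M[R]_(m, n)) i j :
    F s @[s --> within `[0, T] (nbhs t)] --> L ->
    F s i j @[s --> within `[0, T] (nbhs t)] --> L i j.
  by move=> FL; exact: (cvg_comp _ _ FL (@coord_continuous _ _ _ i j _)).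
apply: cvg_mx => i j; rewrite [S t]blockE.
under eq_fun do rewrite [S _]blockE.
case: (split_ordP i) => k ->; last first.
  by rewrite col_mxEd; under eq_fun do rewrite col_mxEd; exact: entry.
rewrite col_mxEu; under eq_fun do rewrite col_mxEu.
case: (split_ordP k) => l ->.
  by rewrite col_mxEu; under eq_fun do rewrite col_mxEu; exact: entry.
by rewrite col_mxEd; under eq_fun do rewrite col_mxEd; exact: entry.
Unshelve. all: end_near. Qed.

(** Only measurability is claimed, since the control block contains the policy Jacobian, which may
    be discontinuous along the path. *)
Lemma linearized_measurable : mx_measurable_on `[0, T] Sh.
Proof.
have [_ _ D1] := lin.
have mD : measurable (`[0, T]%classic : set (measurableTypeR R)).
  exact: measurable_itv.
have mX : mx_measurable_on `[0, T] (fun s => xpart (Sh s)).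
  apply: cont_within_mx_measurable => // t tT.
  by have [_ /deriv_within_cvg] := D1 t tT.
have mZ : mx_measurable_on `[0, T] (fun s => zpart (Sh s)).
  apply: cont_within_mx_measurable => // t tT.
  by have [_ _ /deriv_within_cvg] := D1 t tT.
have mU : mx_measurable_on `[0, T] (fun s => upart (Sh s)).
  apply: (@mx_measurable_eq _ _ _ _
    (fun s => jacobian_cV u (zpart (S s)) *m zpart (Sh s))).
    by move=> t /set_mem tT; have [-> _ _] := D1 t tT.
  apply: mx_measurable_mul => //; apply: jacobian_along_measurable => //.
  exact: nominal_zpart_continuous.
move=> i j; case: (split_ordP i) => k ->; last first.
  apply: (eq_measurable_fun (fun s => zpart (Sh s) k j)); last exact: mZ.
  by move=> s _; rewrite [in RHS](blockE (Sh s)) col_mxEd.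
case: (split_ordP k) => l ->.
  apply: (eq_measurable_fun (fun s => xpart (Sh s) l j)); last exact: mX.
  by move=> s _; rewrite [in RHS](blockE (Sh s)) !col_mxEu.
apply: (eq_measurable_fun (fun s => upart (Sh s) l j)); last exact: mU.
by move=> s _; rewrite [in RHS](blockE (Sh s)) col_mxEu col_mxEd.
Qed.

End trajectory_regularity.

(** * Cost and chance constraints at a convex combination *)

Section costs.
Context {R : realType} {nx nu nz nw : nat} {I : Type}.
Variable P : scp_data R nx nu nz nw I.
Let T := horizon P.
Local Notation leb := (@lebesgue_measure R).
Local Notation N := (nx + nu + nz)%N.

Variables a b : R.
Hypotheses (a0 : 0 <= a) (b0 : 0 <= b) (ab : a + b = 1).
Variables (S1 S2 : R -> 'cV[R]_N) (Sh1 Sh2 : R -> 'M[R]_(N, nz)).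
Local Notation S := (comb a b S1 S2).
Local Notation Sh := (comb a b Sh1 Sh2).
Hypothesis Z12 : forall t, t \in `[0, T] -> zpart (S1 t) = zpart (S2 t).

Let mT : measurable (`[0, T]%classic : set (measurableTypeR R)).
Proof. exact: measurable_itv. Qed.

Let mt t : measurable (`[0, t]%classic : set (measurableTypeR R)).
Proof. exact: measurable_itv. Qed.

Let ZS t : t \in `[0, T] -> zpart (S t) = zpart (S1 t).
Proof. by move=> tT; rewrite zpart_comb -Z12// convex_comb_id. Qed.

(** An equality constraint survives because, with [diffusion] evaluated on the shared path, the
    integrand is linear in [l]. *)
Lemma second_order_cost_comb J1 J2 l1 l2 :
  second_order_cost P S1 J1 l1 -> second_order_cost P S2 J2 l2 ->
  second_order_cost P S (a * J1 + b * J2) (comb a b l1 l2).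
Proof.
pose c (SS : R -> 'cV[R]_N) (l : R -> 'M[R]_nz) t : R :=
  2^-1 * \tr ((diffusion P (zpart (SS t)))^T *m l t *m diffusion P (zpart (SS t))).
move=> [i1 E1] [i2 E2].
have cE : {in `[0, T]%classic, (fun t => a * c S1 l1 t + b * c S2 l2 t) =1
    c S (comb a b l1 l2)}.
  move=> t /set_mem tT; rewrite /c (ZS tT) -(Z12 tT).
  rewrite mulmxDr mulmxDl -!scalemxAr -!scalemxAl linearD/= !linearZ/=.
  by ring.
have ic : integrable_on `[0, T] (c S (comb a b l1 l2)).
  apply: (integrable_on_eq mT cE).
  by apply: integrable_onD => //; exact: integrable_onZ.
split; first exact: ic.
by rewrite E1 E2 -(Rintegral_comb mT a b i1 i2); apply: eq_Rintegral.
Qed.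

Lemma nominal_cost_comb J1 J2 :
  degree_le2 (run_cost P) ->
  @convex_function R 'cV[R]_N setT (run_cost P) ->
  @convex_function R 'cV[R]_N setT (end_cost P) ->
  cont_within `[0, T] S ->
  nominal_cost P S1 J1 -> nominal_cost P S2 J2 ->
  nominal_cost P S (a * J1 + b * J2).
Proof.
move=> df cf cg cS [i1 J1P] [i2 J2P].
(* Convexity bounds the integrand only from above, so integrability is taken from continuity on a
   compact interval. *)
have iS : integrable_on `[0, T] (run_cost P \o S).
  apply: cont_within_integrable => //; first exact: segment_compact.
  exact: (cont_within_comp (degree_le2_continuous df)).
split=> //.
have g_le := convex_functionE (S1 T) (S2 T) cg a0 b0 ab.
have f_le : \int[leb]_(t in `[0, T]) run_cost P (S t) <=
    a * \int[leb]_(t in `[0, T]) run_cost P (S1 t) +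
    b * \int[leb]_(t in `[0, T]) run_cost P (S2 t).
  rewrite -Rintegral_comb//; apply: le_Rintegral => //.
    by apply: integrable_onD => //; exact: integrable_onZ.
  by move=> t _; exact: convex_functionE.
apply: le_trans (lerD f_le g_le) _.
rewrite addrACA -!mulrDr; apply: lerD; exact: ler_wpM2l.
Qed.

(** Constant psd Hessians make the quadratic forms of both right-hand terms convex in [Sh], while
    the left side is linear in [l]; the order is tested one vector [v] at a time. *)
Lemma hessian_constraint_comb l1 l2 :
  degree_le2 (run_cost P) -> degree_le2 (end_cost P) ->
  @convex_function R 'cV[R]_N setT (run_cost P) ->
  @convex_function R 'cV[R]_N setT (end_cost P) ->
  mx_measurable_on `[0, T] Sh1 -> mx_measurable_on `[0, T] Sh2 ->
  (forall t, t \in `[0, T] -> (l1 t)^T = l1 t) ->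
  (forall t, t \in `[0, T] -> (l2 t)^T = l2 t) ->
  hessian_constraint P S1 Sh1 l1 -> hessian_constraint P S2 Sh2 l2 ->
  hessian_constraint P S Sh (comb a b l1 l2).
Proof.
move=> df dg cf cg m1 m2 sl1 sl2.
have [Hf pf hf] := convex_degree_le2_hessian df cf.
have [Hg pg hg] := convex_degree_le2_hessian dg cg.
pose F (Z : R -> 'M[R]_(N, nz)) s := (Z s)^T *m Hf *m Z s.
pose G (Z : R -> 'M[R]_(N, nz)) s := (Z s)^T *m Hg *m Z s.
have hcE (SS : R -> 'cV[R]_N) (Z : R -> 'M[R]_(N, nz)) (l : R -> 'M[R]_nz) :
    hessian_constraint P SS Z l <-> mx_integrable_on `[0, T] (F Z) /\
    forall t, t \in `[0, T] ->
      loewner_ge (l t) (mx_integral `[0, t] (F Z) + G Z t).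
  rewrite /hessian_constraint /=.
  have -> : (fun s => (Z s)^T *m hessian (run_cost P) (SS s) *m Z s) = F Z.
    by apply/funext => s; rewrite hf.
  by split=> -[iF H]; split=> // t /H; rewrite /G hg.
move=> /hcE[i1 L1] /hcE[i2 L2]; apply/hcE.
have conv (H : 'M[R]_N) (v : 'cV[R]_nz) s : psd H ->
    (v^T *m ((Sh s)^T *m H *m Sh s) *m v) 0 0 <=
    a * (v^T *m ((Sh1 s)^T *m H *m Sh1 s) *m v) 0 0 +
    b * (v^T *m ((Sh2 s)^T *m H *m Sh2 s) *m v) 0 0.
  by move=> pH; exact: psd_form_convex.
have iF : mx_integrable_on `[0, T] (F Sh).
  move=> i j.
  (* The dominating function: [psd_entry_le] bounds an entry by two diagonal ones, and each of these
     by convexity of the form at a coordinate vector. *)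
  pose h s := 2^-1 * ((a * F Sh1 s i i + b * F Sh2 s i i) +
                      (a * F Sh1 s j j + b * F Sh2 s j j)).
  have ih : integrable_on `[0, T] h.
    apply: integrable_onZ => //; apply: integrable_onD => //;
      by apply: integrable_onD => //; apply: integrable_onZ.
  apply: (integrable_on_le mT _ _ ih).
    have mSh : mx_measurable_on `[0, T] Sh by exact: mx_measurable_comb.
    have mH := @mx_measurable_cst R `[0, T]%classic _ _ Hf.
    exact: (mx_measurable_mul (mx_measurable_mul (mx_measurable_tr mSh) mH) mSh).
  move=> s _; apply: le_trans (psd_entry_le i j (psd_mulmx (Sh s) pf)) _.
  have diag k : ((Sh s)^T *m Hf *m Sh s) k k <= a * F Sh1 s k k + b * F Sh2 s k k.
    by have := conv Hf (delta_mx k 0) s pf; rewrite !form_delta.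
  by rewrite ler_wpM2l ?invr_ge0// lerD.
split=> // t tT; have tsub := subset_horizon tT.
have iFt (Z : R -> 'M[R]_(N, nz)) :
    mx_integrable_on `[0, T] (F Z) -> mx_integrable_on `[0, t] (F Z).
  by move=> iZ i j; exact: (integrable_onS mT (mt t) tsub (iZ i j)).
have [sy1 fo1] := L1 t tT; have [sy2 fo2] := L2 t tT.
have symI : (mx_integral `[0, t] (F Sh))^T = mx_integral `[0, t] (F Sh).
  apply/matrixP => i j; rewrite !mxE; apply: eq_Rintegral => s _.
  have FT : (F Sh s)^T = F Sh s by case: (psd_mulmx (Sh s) pf).
  by rewrite -[in LHS]FT mxE.
split.
  rewrite linearB/= [(mx_integral _ _ + _)^T]linearD/= symI.
  have -> : (G Sh t)^T = G Sh t by case: (psd_mulmx (Sh t) pg).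
  by rewrite /comb linearD/= !linearZ/= sl1// sl2.
move=> v.
have formD (A B : 'M[R]_nz) : (v^T *m (A + B) *m v) 0 0 =
    (v^T *m A *m v) 0 0 + (v^T *m B *m v) 0 0.
  by rewrite mulmxDr mulmxDl mxE.
have formN (A : 'M[R]_nz) : (v^T *m (- A) *m v) 0 0 = - (v^T *m A *m v) 0 0.
  by rewrite mulmxN mulNmx mxE.
have formZ k (A : 'M[R]_nz) : (v^T *m (k *: A) *m v) 0 0 = k * (v^T *m A *m v) 0 0.
  by rewrite -scalemxAr -scalemxAl mxE.
have [if1 E1] := quad_form_integral (mt t) v (iFt _ i1).
have [if2 E2] := quad_form_integral (mt t) v (iFt _ i2).
have [if0 E0] := quad_form_integral (mt t) v (iFt _ iF).
have := fo1 v; have := fo2 v.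
rewrite !(formD, formN, formZ) E0 E1 E2.
have Ile : \int[leb]_(s in `[0, t]) (v^T *m F Sh s *m v) 0 0 <=
    a * \int[leb]_(s in `[0, t]) (v^T *m F Sh1 s *m v) 0 0 +
    b * \int[leb]_(s in `[0, t]) (v^T *m F Sh2 s *m v) 0 0.
  rewrite -Rintegral_comb//; apply: le_Rintegral => //; last first.
    by move=> s _; exact: conv.
  by apply: integrable_onD => //; exact: integrable_onZ.
have Gle := conv Hg v t pg.
rewrite -![(Sh1 t)^T *m Hg *m Sh1 t]/(G Sh1 t) in Gle *.
move: Ile Gle; rewrite -/(G Sh t) -/(G Sh2 t).
move=> Ile Gle h2 h1; rewrite subr_ge0; rewrite !subr_ge0 in h1 h2.
apply: le_trans (lerD Ile Gle) _; rewrite addrACA -!mulrDr.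
by apply: lerD; exact: ler_wpM2l.
Qed.

(** The square root is the L2 norm of [w], which is linear in [Sh] once [diffusion] is read on the
    shared path. Minkowski's inequality then applies, and [0 <= kappa P] preserves its direction. *)
Lemma chance_constraint_comb :
  0 <= kappa P -> borel_matrix (diffusion P) ->
  cont_within `[0, T] (fun t => zpart (S1 t)) ->
  mx_measurable_on `[0, T] Sh1 -> mx_measurable_on `[0, T] Sh2 ->
  chance_constraint P S1 Sh1 -> chance_constraint P S2 Sh2 ->
  chance_constraint P S Sh.
Proof.
move=> k0 bs cZ m1 m2 C1 C2 i; have [i1 P1] := C1 i; have [i2 P2] := C2 i.
have ms : mx_measurable_on `[0, T] (fun s => diffusion P (zpart (S1 s))).
  exact: (borel_along_measurable mT bs cZ).
pose w (Z : R -> 'M[R]_(N, nz)) s :=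
  (phi P i)^T *m Z s *m diffusion P (zpart (S1 s)).
have mw Z : mx_measurable_on `[0, T] Z -> mx_measurable_on `[0, T] (w Z).
  by move=> mZ; do 2 apply: mx_measurable_mul => //; exact: mx_measurable_cst.
(* The matrix is the product of the transpose of [w Z s] with [w Z s]; cyclicity of the trace turns
   it into a one by one matrix. *)
have vE (SS : R -> 'cV[R]_N) Z s : zpart (SS s) = zpart (S1 s) ->
    \tr ((diffusion P (zpart (SS s)))^T *m (Z s)^T *m phi P i *m (phi P i)^T *m
      Z s *m diffusion P (zpart (SS s))) = sqnorm (w Z s).
  move=> ->; rewrite -mxtrace_tr sqnormE /w.
  set p := phi P i; set s1 := diffusion P _.
  have -> : (s1^T *m (Z s)^T *m p *m p^T *m Z s *m s1) =
      (p^T *m Z s *m s1)^T *m (p^T *m Z s *m s1).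
    by rewrite !trmx_mul trmxK !mulmxA.
  by rewrite trmx_mul trmxK mxtrace_mulC /mxtrace big_ord1.
have wE s : w Sh s = a *: w Sh1 s + b *: w Sh2 s.
  by rewrite /w mulmxDr mulmxDl -!scalemxAr -!scalemxAl.
have iw1 : integrable_on `[0, T] (fun s => sqnorm (w Sh1 s)).
  by apply: integrable_on_eq i1 => // s _; exact: vE.
have iw2 : integrable_on `[0, T] (fun s => sqnorm (w Sh2 s)).
  by apply: integrable_on_eq i2 => // s /set_mem sT; rewrite vE// Z12.
have [iw _] := minkowski_sqnorm mT a0 b0 ab (mw _ m1) (mw _ m2) iw1 iw2.
split.
  apply: integrable_on_eq iw => // s /set_mem sT.
  by rewrite vE ?ZS// wE.
move=> t tT; have tsub := subset_horizon tT.
have mwt Z : mx_measurable_on `[0, T] Z -> mx_measurable_on `[0, t] (w Z).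
  by move=> /mw mZ j k; exact: (measurable_funS mT tsub).
have iwt Z : integrable_on `[0, T] (fun s => sqnorm (w Z s)) ->
    integrable_on `[0, t] (fun s => sqnorm (w Z s)).
  exact: (integrable_onS mT (mt t) tsub).
have [_ mink] := minkowski_sqnorm (mt t) a0 b0 ab (mwt _ m1) (mwt _ m2)
  (iwt _ iw1) (iwt _ iw2).
have := lerD (ler_wpM2l a0 (P1 t tT)) (ler_wpM2l b0 (P2 t tT)).
rewrite -mulrDl ab mul1r => /(le_trans _); apply.
have SE : ((phi P i)^T *m S t) 0 0 =
    a * ((phi P i)^T *m S1 t) 0 0 + b * ((phi P i)^T *m S2 t) 0 0.
  by rewrite mulmxDr -!scalemxAr !mxE.
have IE (SS : R -> 'cV[R]_N) Z :
    (forall s, s \in `[0, T] -> zpart (SS s) = zpart (S1 s)) ->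
    \int[leb]_(s in `[0, t]) \tr ((diffusion P (zpart (SS s)))^T *m (Z s)^T *m
      phi P i *m (phi P i)^T *m Z s *m diffusion P (zpart (SS s))) =
    \int[leb]_(s in `[0, t]) sqnorm (w Z s).
  by move=> ZE; apply: eq_Rintegral => s /set_mem /tsub sT; rewrite vE ?ZE.
rewrite !IE//; last by move=> s sT; rewrite Z12.
rewrite SE (_ : \int[leb]_(s in `[0, t]) sqnorm (w Sh s) =
  \int[leb]_(s in `[0, t]) sqnorm (a *: w Sh1 s + b *: w Sh2 s)); last first.
  by apply: eq_Rintegral => s _; rewrite wE.
apply: le_trans (lerD (ler_wpM2l k0 mink) (lexx _)) _.
by rewrite le_eqVlt; apply/orP; left; apply/eqP; ring.
Qed.
End costs.

(** * Convexity of the objective and of the feasible set *)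

Unset Implicit Arguments.
Set Strict Implicit.
Set Printing Implicit Defensive.

Theorem mainTheorem2 (R : realType) (nx nu nz nw : nat) (I : Type)
    (P : scp_data R nx nu nz nw I)
    (T_gt0 : 0 < horizon P)
    (kappa_ge0 : 0 <= kappa P)
    (drift_diff : forall z, differentiable (drift P) z)
    (drift_lip : locally_lipschitz (drift P))
    (diffusion_borel : borel_matrix (diffusion P))
    (policies_diff : forall u, policies P u -> forall z, differentiable u z)
    (f_convex : @convex_function R 'cV[R]_(nx + nu + nz) setT (run_cost P))
    (g_convex : @convex_function R 'cV[R]_(nx + nu + nz) setT (end_cost P))
    (f_quadratic : degree_le2 (run_cost P))
    (g_quadratic : degree_le2 (end_cost P))
    (U_convex : @convex_set R ('cV[R]_nz -> 'cV[R]_nu) (policies P)) :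
  convex_problem (scp_objective (R := R)) (scp_feasible P).
Proof.
split.
  move=> p [[[[[u1 S1] Sh1] J01] J11] l1] [[[[[u2 S2] Sh2] J02] J12] l2] _ _.
  have E (a b x1 x2 y1 y2 : R) :
    (a * x1 + b * x2) + (a * y1 + b * y2) = a * (x1 + y1) + b * (x2 + y2).
    by rewrite !mulrDr addrACA.
  (* The objective is linear, so the convexity inequality is an equality. *)
  rewrite le_eqVlt; apply/orP; left; apply/eqP.
  exact (E p%:num (1 - p%:num) J01 J02 J11 J12).
move=> [[[[[u1 S1] Sh1] J01] J11] l1] [[[[[u2 S2] Sh2] J02] J12] l2] p.
move=> /set_mem /= [U1 sl1 [nom1 lin1] [so1 nc1] [hc1 cc1]].
move=> /set_mem /= [U2 sl2 [nom2 lin2] [so2 nc2] [hc2 cc2]].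
have Uc := set_mem (U_convex u1 u2 p (mem_set U1) (mem_set U2)).
apply/mem_set.
have a0 : 0 <= p%:num by [].
have b0 : 0 <= 1 - p%:num by rewrite subr_ge0.
have ab : p%:num + (1 - p%:num) = 1 by rewrite addrC subrK.
have [du1 du2] := (policies_diff _ U1, policies_diff _ U2).
have Z12 t (tT : t \in `[0, horizon P]) :=
  nominal_dynamics_unique drift_lip nom1 nom2 tT.
have nom := nominal_dynamics_comb drift_lip ab nom1 nom2.
have lin := linearized_dynamics_comb drift_diff drift_lip ab du1 du2
  nom1 nom2 lin1 lin2.
have [m1 m2] := (linearized_measurable du1 nom1 lin1,
  linearized_measurable du2 nom2 lin2).
(* The vector space operations on tuples and functions unfold to the componentwise combinations
   [comb]. *)
change (scp_feasible P
  (comb p%:num (1 - p%:num) u1 u2, comb p%:num (1 - p%:num) S1 S2,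
   comb p%:num (1 - p%:num) Sh1 Sh2, p%:num * J01 + (1 - p%:num) * J02,
   p%:num * J11 + (1 - p%:num) * J12, comb p%:num (1 - p%:num) l1 l2)).
split=> //.
- by move=> t tT; rewrite /comb linearD/= !linearZ/= sl1// sl2.
- split; first exact: second_order_cost_comb.
  apply: nominal_cost_comb => //.
  (* The combined policy is differentiable because convexity places it in [policies P]. *)
  apply: nominal_continuous nom => z.
  exact: (policies_diff _ Uc z).
- split; first exact: hessian_constraint_comb.
  apply: chance_constraint_comb => //.
  exact: nominal_zpart_continuous nom1.
Qed.
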